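(* Let $\mathbb{F}_q$ be a finite field, let $1\le k\le n-k$, and fix a decomposition $\mathbb{F}_q^n=V\oplus W$ with $\dim V=k$, $\dim W=n-k$. The elements of the double coset space $U_{(k,n-k)}\backslash GL_n(\mathbb{F}_q)/U_{(k,n-k)}$ are in one-to-one correspondence with quadruples $(C,A,D,B)$ of linear maps $$C\in\mathrm{Hom}(V,W),\quad A\in\mathrm{Hom}(\ker C,V),\quad D\in\mathrm{Hom}(W,W/\mathrm{im}\,C),\quad B\in\mathrm{Hom}(\ker D,V/\mathrm{im}\,A)$$ such that $A$ is injective, $D$ is surjective and $B$ is an isomorphism.
   Context: $GL_n(\mathbb{F}_q)$ acts on $\mathbb{F}_q^n=V\oplus W$, and an element is written in block form $g=\begin{pmatrix}A&B\\C&D\end{pmatrix}$ with $A\in\mathrm{Hom}(V,V)$, $B\in\mathrm{Hom}(W,V)$, $C\in\mathrm{Hom}(V,W)$, $D\in\mathrm{Hom}(W,W)$. $U_{(k,n-k)}$ is the subgroup of elements of the form $\begin{pmatrix}1&X\\0&1\end{pmatrix}$, $X\in\mathrm{Hom}(W,V)$. All $\mathrm{Hom}$ spaces are spaces of $\mathbb{F}_q$-linear maps. *)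

(* Defs.v *)
From HB Require Import structures.
From mathcomp Require Import all_boot all_order all_algebra all_fingroup.
From mathcomp Require Import generic_quotient ring_quotient.

Set Implicit Arguments.
Unset Strict Implicit.
Unset Printing Implicit Defensive.

Import GRing.Theory.
Local Open Scope ring_scope.
Local Open Scope quotient_scope.

(* The quotient space vT / U, i.e. MathComp's quotient of the additive group  *)
(* vT by U, equipped with its scalar multiplication.                          *)
Section QuotientSpace.

Import VectorInternalTheory.

Variables (K : fieldType) (vT : vectType K) (U : {vspace vT}).

Definition quotv : Type := @Quotient.quot vT U.

HB.instance Definition _ := Choice.on quotv.
HB.instance Definition _ := GRing.Zmodule.on quotv.

Definition quotv_class (v : vT) : quotv := \pi_(@Quotient.quot vT U) v.
Definition quotv_repr (c : quotv) : vT := repr (c : @Quotient.quot vT U).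

Lemma quotv_reprK c : quotv_class (quotv_repr c) = c.
Proof. exact: reprK. Qed.

Lemma quotv_classE v w : (quotv_class v == quotv_class w) = (v - w \in U).
Proof. by rewrite (Quotient.idealrBE U v w). Qed.

Lemma quotv_class_zmod : zmod_morphism quotv_class.
Proof. by move=> v w; exact: (raddfB (\pi_(@Quotient.quot vT U))). Qed.

HB.instance Definition _ :=
  GRing.isZmodMorphism.Build vT quotv quotv_class quotv_class_zmod.

Definition quotv_scale (a : K) (c : quotv) : quotv :=
  quotv_class (a *: quotv_repr c).

Lemma quotv_scaleE a v : quotv_scale a (quotv_class v) = quotv_class (a *: v).
Proof.
apply/eqP; rewrite quotv_classE -scalerBr memvZ //.
by rewrite -quotv_classE quotv_reprK.
Qed.

Fact quotv_scaleA a b c :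
  quotv_scale a (quotv_scale b c) = quotv_scale (a * b) c.
Proof. by rewrite -[c]quotv_reprK !quotv_scaleE scalerA. Qed.

Fact quotv_scale1 : left_id 1 quotv_scale.
Proof. by move=> c; rewrite -[c]quotv_reprK quotv_scaleE scale1r. Qed.

Fact quotv_scaleDr : right_distributive quotv_scale +%R.
Proof.
move=> a c d; rewrite -[c]quotv_reprK -[d]quotv_reprK -raddfD.
by rewrite !quotv_scaleE scalerDr raddfD.
Qed.

Fact quotv_scaleDl c : {morph quotv_scale^~ c : a b / a + b}.
Proof.
by move=> a b; rewrite -[c]quotv_reprK !quotv_scaleE scalerDl raddfD.
Qed.

HB.instance Definition _ := GRing.Zmodule_isLmodule.Build K quotv
  quotv_scaleA quotv_scale1 quotv_scaleDr quotv_scaleDl.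

Lemma quotv_class_is_scalable : scalable quotv_class.
Proof. by move=> a v; rewrite -quotv_scaleE. Qed.

HB.instance Definition _ :=
  GRing.isScalable.Build K vT quotv *:%R quotv_class quotv_class_is_scalable.

Let proj (v : vT) : subvs_of (U^C)%VS := vsproj (U^C)%VS (v - projv U v).

Let proj_repr v : proj (quotv_repr (quotv_class v)) = proj v.
Proof.
have: quotv_repr (quotv_class v) - v \in U by rewrite -quotv_classE quotv_reprK.
set r := quotv_repr _ => rvU; rewrite /proj; congr (vsproj _ _).
by rewrite -[r](subrK v) linearD /= (projv_id rvU) opprD addrACA subrr add0r.
Qed.

Fact quotv_vect_iso : Vector.axiom (dim (subvs_of (U^C)%VS)) quotv.
Proof.
exists (fun c => v2r (proj (quotv_repr c))).
  move=> a c d; rewrite -[c]quotv_reprK -[d]quotv_reprK -linearP !proj_repr.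
  rewrite -linearP /proj /= -linearP /=; congr (v2r (vsproj _ _)).
  by rewrite linearP /= scalerBr opprD addrACA.
exists (fun r => quotv_class (vsval (r2v r))).
  move=> c; rewrite v2rK vsprojK ?memv_projC // -[RHS]quotv_reprK.
  apply/eqP; rewrite quotv_classE addrAC subrr add0r memvN; exact: memv_proj.
move=> r; rewrite proj_repr /proj.
have /eqP -> : projv U (vsval (r2v r)) == 0.
  by rewrite -memv_ker lker_proj subvsP.
by rewrite subr0 vsvalK r2vK.
Qed.

HB.instance Definition _ := Lmodule_hasFinDim.Build K quotv quotv_vect_iso.

Definition quotv_proj : 'Hom(vT, quotv) := linfun quotv_class.

Lemma lker_quotv_proj : lker quotv_proj = U.
Proof.
apply/vspaceP=> v; rewrite memv_ker lfunE /= -(linear0 quotv_class).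
by rewrite quotv_classE subr0.
Qed.

Lemma limg_quotv_proj : limg quotv_proj = fullv.
Proof.
apply/vspaceP=> c; rewrite memvf -[c]quotv_reprK.
by rewrite -[quotv_class _](lfunE quotv_class) memv_img ?memvf.
Qed.

End QuotientSpace.

(* g in 'GL_n[F] acts on columns by v |-> g *m v.  The matrices in            *)
(* {'GL_n[F]} have size n.-1.+1, which is n as soon as n > 0.                 *)
Section Blocks.

Variables (F : finFieldType) (n : nat).
Implicit Types (g : {'GL_n[F]}) (V W P Q : {vspace 'cV[F]_n.-1.+1}).

Definition GLact g : 'End('cV[F]_n.-1.+1) := linfun (mulmx (GLval g)).

Definition proj_along Q Q' : 'Hom('cV[F]_n.-1.+1, subvs_of Q) :=
  linfun (vsproj Q \o daddv_pi Q Q').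

(* The component Hom(P, Q) of g, where Q' is the chosen complement of Q.      *)
Definition block P Q Q' g : 'Hom(subvs_of P, subvs_of Q) :=
  (proj_along Q Q' \o GLact g \o linfun vsval)%VF.

Definition blockA V W := block V V W.
Definition blockB V W := block W V W.
Definition blockC V W := block V W V.
Definition blockD V W := block W W V.

Lemma blockE P Q Q' g (v : subvs_of P) :
  vsval (block P Q Q' g v) = daddv_pi Q Q' (GLval g *m vsval v).
Proof.
by rewrite /block comp_lfunE [in LHS]comp_lfunE !lfunE /= vsprojK ?memv_pi.
Qed.

Lemma block_add P Q Q' g (v : subvs_of P) :
  directv (Q + Q') -> (Q + Q')%VS = fullv ->
  GLval g *m vsval v = vsval (block P Q Q' g v) + vsval (block P Q' Q g v).
Proof.
move=> /directv_addP QQ' sumQ.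
by rewrite !blockE daddv_pi_add // sumQ memvf.
Qed.

Definition unip V W : {set {'GL_n[F]}} :=
  [set g | [&& blockA V W g == \1%VF, blockC V W g == 0 &
               blockD V W g == \1%VF]].

End Blocks.

Definition double_cosets (gT : finGroupType) (H G K : {set gT}) :
    {set {set gT}} :=
  [set (H :* g * K)%g | g in G].

Definition double_coset_space (gT : finGroupType) (H G K : {set gT}) : Type :=
  {X : {set gT} | X \in double_cosets H G K}.

Section Quadruples.

Variables (F : fieldType) (vT wT : vectType F).

Record quadruple := Quadruple {
  quadC : 'Hom(vT, wT);
  quadA : 'Hom(subvs_of (lker quadC), vT);
  quadD : 'Hom(wT, quotv (limg quadC));
  quadB : 'Hom(subvs_of (lker quadD), quotv (limg quadA)) }.

Definition admissible (x : quadruple) : bool :=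
  [&& lker (quadA x) == 0%VS, limg (quadD x) == fullv,
      lker (quadB x) == 0%VS & limg (quadB x) == fullv].

Definition admissible_quadruple : Type := {x : quadruple | admissible x}.

Lemma admissibleP (x : quadruple) :
  reflect [/\ injective (quadA x), forall c, exists w, quadD x w = c
            & bijective (quadB x)] (admissible x).
Proof.
have surjP (aT rT : vectType F) (f : 'Hom(aT, rT)) :
    reflect (forall c, exists w, f w = c) (limg f == fullv).
  apply: (iffP eqP) => [fT c | f_surj].
    have: c \in limg f by rewrite fT memvf.
    by case/memv_imgP=> w _ ->; exists w.
  apply/vspaceP=> c; rewrite memvf; have [w <-] := f_surj c.
  by rewrite memv_img ?memvf.
apply: (iffP and4P) => [[/lker0P Ai /surjP Ds Bi Bs] | [Ai Ds Bb]]; split=> //.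
- exists (quadB x)^-1%VF; first exact: lker0_lfunK.
  by move=> c; rewrite limg_lfunVK // (eqP Bs) memvf.
- exact/lker0P.
- exact/surjP.
- exact/lker0P/bij_inj.
- by apply/surjP=> c; case: Bb => h _ hK; exists (h c).
Qed.

End Quadruples.

(* x is the quadruple read off from the blocks of g: A and D are restricted   *)
(* to ker C and reduced modulo im C, and B sends w in ker D to the class of   *)
(* B w - A v, for any v such that C v = D w.                                  *)
Definition quadruple_of (F : finFieldType) (n : nat)
    (V W : {vspace 'cV[F]_n.-1.+1}) (g : {'GL_n[F]})
    (x : quadruple (subvs_of V) (subvs_of W)) : Prop :=
  [/\ quadC x = blockC V W g,
      forall v : subvs_of (lker (quadC x)), quadA x v = blockA V W g (vsval v),
      forall w : subvs_of W, quadD x w = quotv_proj _ (blockD V W g w)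
    & forall (w : subvs_of (lker (quadD x))) (v : subvs_of V),
        blockC V W g v = blockD V W g (vsval w) ->
        quadB x w =
          quotv_proj _ (blockB V W g (vsval w) - blockA V W g v)].

(* Main.v *)
Require Import Defs.
From mathcomp Require Import all_boot all_order all_algebra all_fingroup.

Import GRing.Theory.
Local Open Scope ring_scope.

(** Multiplying a block matrix (a b; c d) on the left by (1 X; 0 1) and on the
    right by (1 Y; 0 1) gives
      (a + Xc   (a + Xc)Y + b + Xd;   c   d + cY).
    So c is an invariant of the double coset, a is one on ker c, where Xc
    vanishes, and d is one modulo im c, where cY vanishes.  If w lies in the
    kernel of d modulo im c, choose v with cv = dw; the class of bw - av modulo
    a(ker c) depends neither on the choice of v nor on X and Y
    ([blocks_quadruple_unip]).  These four invariants form the quadruple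
    (C, A, D, B).

    When cv = dw, the matrix sends (-v, w) to (bw - av, 0).  Hence, for an
    invertible matrix, a zero of B gives a zero of the matrix, and a preimage of
    (t, 0) gives a preimage under B of the class of t; with similar arguments
    for A and D, the quadruple is admissible
    ([blocks_quadruple_admissible]).  Conversely, extending A to V, lifting D to
    W and correcting a lift of B by av realises any quadruple
    ([blocks_quadruple_exists]), and the result is injective, hence invertible,
    when the quadruple is admissible ([block_fun_injective]).

    Finally the quadruple separates the double cosets
    ([blocks_quadruple_orbit]): if two matrices have the same quadruple, then
    a' - a kills ker c, so it is Xc for some X, and d' - d has values in im c,
    so it is cY for some Y.  After this change only the upper right corners
    differ.  Their difference e maps ker D into a(ker c), so on ker D it agrees
    with aY for some Y with values in ker c, and e - aY, which kills ker D,
    factors through D, hence is Xd for some X that kills im c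
    ([blocks_quadruple_corner]). *)

Set Implicit Arguments.
Unset Strict Implicit.
Unset Printing Implicit Defensive.

(** * Factoring linear maps *)

Section Factor.

Variable K : fieldType.

Lemma lfun_factorl (aT bT cT : vectType K)
    (f : 'Hom(aT, bT)) (g : 'Hom(aT, cT)) :
  (lker g <= lker f)%VS -> f = (f \o g^-1 \o g)%VF.
Proof.
move=> /subvP sgf; apply/lfunP=> u; rewrite !comp_lfunE; apply/eqP.
rewrite -subr_eq0 -linearB -memv_ker; apply: sgf.
by rewrite memv_ker linearB /= limg_lfunVK ?subrr ?memv_img ?memvf.
Qed.

Lemma lfun_factorr (aT bT cT : vectType K)
    (f : 'Hom(aT, bT)) (g : 'Hom(cT, bT)) :
  (limg f <= limg g)%VS -> f = (g \o (g^-1 \o f))%VF.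
Proof.
move=> /subvP sfg; apply/lfunP=> u; rewrite !comp_lfunE limg_lfunVK //.
by apply: sfg; rewrite memv_img ?memvf.
Qed.

Lemma quotv_projE (vT : vectType K) (U : {vspace vT}) (u v : vT) :
  (quotv_proj U u == quotv_proj U v) = (u - v \in U).
Proof. by rewrite !lfunE /= quotv_classE. Qed.

Lemma quotv_proj_eq0 (vT : vectType K) (U : {vspace vT}) (u : vT) :
  (quotv_proj U u == 0) = (u \in U).
Proof. by rewrite -(linear0 (quotv_proj U)) quotv_projE subr0. Qed.

Lemma quotv_projVK (vT : vectType K) (U : {vspace vT}) :
  cancel (quotv_proj U)^-1%VF (quotv_proj U).
Proof. by move=> c; rewrite limg_lfunVK // limg_quotv_proj memvf. Qed.

(** Plain [lfunE] would also unfold [quotv_proj], which is a [linfun] too. *)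
Lemma lfun_vsvalE (vT : vectType K) (U : {vspace vT}) (u : subvs_of U) :
  linfun (@vsval K vT U) u = vsval u.
Proof. exact: lfunE. Qed.

End Factor.

(** * The quadruple of a block map *)

Section Blocks.

Variables (K : fieldType) (vT wT : vectType K).
Implicit Types (a : 'End(vT)) (b : 'Hom(wT, vT)) (c : 'Hom(vT, wT)).
Implicit Types (d : 'End(wT)) (x y : quadruple vT wT).

(** The relation [quadruple_of] for four linear maps that need not come from a
    matrix: it lets the linear algebra be done without coordinates. *)
Definition blocks_quadruple a b c d x : Prop :=
  [/\ quadC x = c,
      forall v : subvs_of (lker (quadC x)), quadA x v = a (vsval v),
      forall w, quadD x w = quotv_proj _ (d w)
    & forall (w : subvs_of (lker (quadD x))) (v : vT),
        c v = d (vsval w) -> quadB x w = quotv_proj _ (b (vsval w) - a v)].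

Lemma blocks_quadruple_lift a b c d x (w : subvs_of (lker (quadD x))) :
  blocks_quadruple a b c d x -> exists v, c v = d (vsval w).
Proof.
case: x w => C A D B w [/= eC _ eD _]; subst C.
have := subvsP w; rewrite memv_ker eD quotv_proj_eq0.
by case/memv_imgP=> v _ ->; exists v.
Qed.

Lemma blocks_quadruple_uniq a b c d x y :
  blocks_quadruple a b c d x -> blocks_quadruple a b c d y -> x = y.
Proof.
move=> qx qy; have lift w := blocks_quadruple_lift w qx.
(* The type of each component depends on the earlier ones, so these have to be
   identified first, in the order C, A, D, B. *)
case: x y qx qy lift => C A D B [C' A' D' B'].
move=> [/= eC eA eD eB] [/= eC' eA' eD' eB']; subst C C' => lift.
have eAA : A = A' by apply/lfunP=> v; rewrite eA eA'.
have eDD : D = D' by apply/lfunP=> w; rewrite eD eD'.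
subst A' D'; congr Quadruple; apply/lfunP=> w.
by have [v cv] := lift w; rewrite (eB _ _ cv) (eB' _ _ cv).
Qed.

(** The generalised inverse of c provides the v with c v = d w that enters the
    last component. *)
Definition reduce_blocks a b c d : quadruple vT wT :=
  let A := (a \o linfun (@vsval K vT (lker c)))%VF in
  let D := (quotv_proj (limg c) \o d)%VF in
  @Quadruple K vT wT c A D
    (quotv_proj (limg A) \o (b - (a \o (c^-1 \o d)))
      \o linfun (@vsval K wT (lker D)))%VF.

Lemma reduce_blocksP a b c d : blocks_quadruple a b c d (reduce_blocks a b c d).
Proof.
split=> [|v|w|w v cv] //=; first by rewrite comp_lfunE lfun_vsvalE.
  by rewrite comp_lfunE.
rewrite comp_lfunE lfun_vsvalE comp_lfunE; apply/eqP; rewrite quotv_projE.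
rewrite add_lfunE opp_lfunE !comp_lfunE opprB addrC addrA subrK -linearB /=.
(* Two choices of v differ by an element of ker c. *)
have ker_v : v - (c^-1)%VF (d (vsval w)) \in lker c.
  by rewrite memv_ker linearB /= -cv limg_lfunVK ?subrr ?memv_img ?memvf.
have -> : a (v - (c^-1)%VF (d (vsval w))) =
    (a \o linfun (@vsval K vT (lker c)))%VF
      (vsproj (lker c) (v - (c^-1)%VF (d (vsval w)))).
  by rewrite comp_lfunE lfun_vsvalE vsprojK.
exact/memv_img/memvf.
Qed.

Definition block_fun a b c d (p : vT * wT) : vT * wT :=
  (a p.1 + b p.2, c p.1 + d p.2).

Lemma block_fun_inj a b c d a' b' c' d' :
  block_fun a b c d =1 block_fun a' b' c' d' ->
  [/\ a = a', b = b', c = c' & d = d'].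
Proof.
move=> e; split; apply/lfunP=> u.
- by have [] := e (u, 0); rewrite /= !linear0 !addr0.
- by have [] := e (0, u); rewrite /= !linear0 !add0r.
- by have [] := e (u, 0); rewrite /= !linear0 !addr0.
- by have [] := e (0, u); rewrite /= !linear0 !add0r.
Qed.

(** Injectivity of A and B comes from the kernel of the block map: A v = 0 puts
    (v, 0) in it, and B w = 0 means bw - av = au with cv = dw and cu = 0, which
    puts (-(v + u), w) in it.  Surjectivity of D and B comes from preimages of
    (0, t) and of (t, 0). *)
Lemma blocks_quadruple_admissible a b c d x :
  bijective (block_fun a b c d) -> blocks_quadruple a b c d x -> admissible x.
Proof.
case=> h hK Kh qx; have lift w := blocks_quadruple_lift w qx.
have inj0 v w : a v + b w = 0 -> c v + d w = 0 -> v = 0 /\ w = 0.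
  move=> eV eW; suff [] : (v, w) = (0, 0) by [].
  by rewrite -[LHS]hK -[RHS]hK /block_fun /= eV eW !linear0 !addr0.
case: x qx lift => C A D B [/= eC eA eD eB]; subst C => lift.
apply/and4P; split=> /=.
- rewrite -subv0; apply/subvP=> u; rewrite memv_ker eA memv0 => /eqP au0.
  have /eqP cu0 : c (vsval u) == 0 by rewrite -memv_ker subvsP.
  have [] := @inj0 (vsval u) 0; rewrite ?linear0 ?addr0 // => u0 _.
  by apply/eqP/val_inj.
- apply/eqP/vspaceP=> t; rewrite memvf -[t]quotv_projVK.
  have := Kh (0, (quotv_proj (limg c))^-1%VF t); case: (h _) => v w [_ /= <-].
  apply/memv_imgP; exists w; rewrite ?memvf // eD; apply/eqP.
  by rewrite quotv_projE addrK memv_img ?memvf.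
- rewrite -subv0; apply/subvP=> w; have [v cv] := lift w.
  rewrite memv_ker (eB _ _ cv) quotv_proj_eq0 memv0 => /memv_imgP [u _].
  rewrite eA => au; apply/eqP/val_inj => /=.
  have /eqP cu0 : c (vsval u) == 0 by rewrite -memv_ker subvsP.
  have [] // := @inj0 (- (v + vsval u)) (vsval w).
    by rewrite linearN linearD /= -au [a v + _]addrC subrK addNr.
  by rewrite linearN linearD /= cu0 cv addr0 addNr.
apply/eqP/vspaceP=> t; rewrite memvf -[t]quotv_projVK.
have := Kh ((quotv_proj (limg A))^-1%VF t, 0).
case: (h _) => v w [/= <- cd0].
have cv : c (- v) = d w.
  by apply/eqP; rewrite linearN eq_sym -addr_eq0 addrC cd0.
have wK : w \in lker D.
  by rewrite memv_ker eD quotv_proj_eq0 -cv memv_img ?memvf.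
apply/memv_imgP; exists (vsproj (lker D) w); rewrite ?memvf //.
by rewrite (eB _ (- v)) ?vsprojK // linearN opprK addrC.
Qed.

(** If (v, w) is in the kernel, then c(-v) = dw, so w is in ker D and B w is the
    class of bw + av = 0; hence w = 0, and then v is in ker c with A v = 0. *)
Lemma block_fun_injective a b c d x :
  blocks_quadruple a b c d x -> admissible x -> injective (block_fun a b c d).
Proof.
case: x => C A D B [/= eC eA eD eB]; subst C.
move=> /and4P[/= /lker0P Ainj _ /lker0P Binj _].
suff inj0 v w : a v + b w = 0 -> c v + d w = 0 -> v = 0 /\ w = 0.
  move=> [v w] [v' w'] [/= eV eW].
  have [] := inj0 (v - v') (w - w').
  - by rewrite !linearB /= addrACA -opprD eV subrr.
  - by rewrite !linearB /= addrACA -opprD eW subrr.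
  by move/subr0_eq=> -> /subr0_eq ->.
move=> eV eW; have cv : c (- v) = d w.
  by apply/eqP; rewrite linearN eq_sym -addr_eq0 addrC eW.
have wK : w \in lker D.
  by rewrite memv_ker eD quotv_proj_eq0 -cv memv_img ?memvf.
have w0 : w = 0.
  rewrite -(vsprojK wK) (_ : vsproj _ w = 0) //; apply: Binj.
  rewrite (eB _ (- v)) ?vsprojK // linearN opprK addrC eV.
  by rewrite !linear0.
move: eV eW; rewrite w0 !linear0 !addr0 => av cv0; split=> //.
have vK : v \in lker c by rewrite memv_ker cv0.
rewrite -(vsprojK vK) (_ : vsproj _ v = 0) //; apply: Ainj.
by rewrite eA vsprojK // av linear0.
Qed.

(** A and D are extended and lifted arbitrarily; the term a c^-1 d in b is what
    the definition of the last component subtracts again. *)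
Lemma blocks_quadruple_exists x :
  {a : 'End(vT) & {b : 'Hom(wT, vT) & {d : 'End(wT) |
    blocks_quadruple a b (quadC x) d x}}}.
Proof.
case: x => C A D B /=.
pose a := (A \o linfun (vsproj (lker C)))%VF.
pose d := ((quotv_proj (limg C))^-1 \o D)%VF.
pose b0 := ((quotv_proj (limg A))^-1 \o (B \o linfun (vsproj (lker D))))%VF.
have aE (v : subvs_of (lker C)) : a (vsval v) = A v.
  by rewrite comp_lfunE lfunE /= vsvalK.
exists a, (b0 + (a \o (C^-1 \o d)))%VF, d; split=> //= [w | w v cv].
  by rewrite comp_lfunE quotv_projVK.
have <- : quotv_proj (limg A) (b0 (vsval w)) = B w.
  by rewrite comp_lfunE quotv_projVK comp_lfunE lfunE /= vsvalK.
apply/eqP; rewrite quotv_projE add_lfunE [(a \o _)%VF _]comp_lfunE.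
rewrite [(_ \o d)%VF _]comp_lfunE -cv -addrA opprD addrA subrr sub0r.
rewrite memvN -linearB /=.
have vK : (C^-1)%VF (C v) - v \in lker C.
  by rewrite memv_ker linearB /= limg_lfunVK ?subrr ?memv_img ?memvf.
by rewrite -(vsprojK vK) aE memv_img ?memvf.
Qed.

(** * Unipotent changes of the blocks *)

Lemma block_fun_unip a b c d (X Y : 'Hom(wT, vT)) p :
  block_fun \1%VF X 0 \1%VF (block_fun a b c d (block_fun \1%VF Y 0 \1%VF p)) =
  block_fun (a + (X \o c))%VF (((a + (X \o c)) \o Y) + (b + (X \o d)))%VF
    c (d + (c \o Y))%VF p.
Proof.
case: p => v w; rewrite /block_fun /= !zero_lfunE !id_lfunE !add0r.
rewrite !add_lfunE [((a + _) \o Y)%VF _]comp_lfunE !add_lfunE !comp_lfunE.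
rewrite !linearD /=; congr pair; last by rewrite -addrA [d w + _]addrC.
rewrite -!addrA; congr (_ + _); rewrite [RHS]addrCA; congr (_ + _).
by rewrite [LHS]addrCA; congr (_ + _); rewrite [LHS]addrCA.
Qed.

(** Invariance of the last component: if c v = (d + cY) w, then v - Y w is a
    valid choice for the original blocks, and it gives the same vector. *)
Lemma blocks_quadruple_unip a b c d x (X Y : 'Hom(wT, vT)) :
  blocks_quadruple a b c d x ->
  blocks_quadruple (a + (X \o c))%VF
    (((a + (X \o c)) \o Y) + (b + (X \o d)))%VF c (d + (c \o Y))%VF x.
Proof.
case: x => C A D B [/= eC eA eD eB]; subst C; split=> //= [v | w | w v].
- rewrite eA add_lfunE comp_lfunE.
  have /eqP -> : c (vsval v) == 0 by rewrite -memv_ker subvsP.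
  by rewrite linear0 addr0.
- rewrite eD; apply/eqP.
  rewrite quotv_projE add_lfunE comp_lfunE opprD addrA subrr sub0r.
  by rewrite memvN memv_img ?memvf.
rewrite add_lfunE comp_lfunE => cv.
rewrite (eB w (v - Y (vsval w))); last by rewrite linearB /= cv addrK.
congr (quotv_proj _ _).
rewrite !add_lfunE [in RHS]comp_lfunE !add_lfunE !comp_lfunE cv.
rewrite !linearD !linearN /= !opprK -opprD.
rewrite [X (d _) + _ in RHS]addrC [in RHS]addrACA.
rewrite [X (c _) + _ in RHS]addrC addrKA.
rewrite [in RHS]addrAC [b _ - X _]addrC addrA addrK addrC.
by rewrite [LHS]addrCA [b _ + _]addrC.
Qed.

(** The unipotent changes that fix a, c and d are those with X c = 0 and
    c Y = 0; they act transitively on the corners b with a given quadruple. *)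
Lemma blocks_quadruple_corner a b b' c d x :
    blocks_quadruple a b c d x -> blocks_quadruple a b' c d x ->
  exists X Y, [/\ (X \o c)%VF = 0, (c \o Y)%VF = 0 &
                  b' = ((a \o Y) + (b + (X \o d)))%VF].
Proof.
move=> qx qx'; have lift w := blocks_quadruple_lift w qx.
case: x qx qx' lift => C A D B [/= eC eA eD eB] [/= _ _ _ eB'] lift; subst C.
have EA : (limg ((b' - b) \o projv (lker D)) <= limg A)%VS.
  apply/subvP=> _ /memv_imgP [w _ ->]; rewrite comp_lfunE.
  have /vsprojK <- := memv_proj (lker D) w.
  have [v cv] := lift (vsproj _ (projv (lker D) w)).
  have /eqP := etrans (esym (eB' _ _ cv)) (eB _ _ cv).
  by rewrite quotv_projE opprB addrA subrK !lfunE /= !lfunE.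
pose Y := (linfun (@vsval K vT (lker c))
             \o (A^-1 \o ((b' - b) \o projv (lker D))))%VF.
have aYE : (a \o Y)%VF = ((b' - b) \o projv (lker D))%VF.
  rewrite [RHS](lfun_factorr EA); apply/lfunP=> w.
  by rewrite [LHS]comp_lfunE [Y w]comp_lfunE lfun_vsvalE [RHS]comp_lfunE eA.
pose e := b' - b - (a \o Y)%VF.
have De : (lker D <= lker e)%VS.
  apply/subvP=> w wK; rewrite memv_ker /e aYE add_lfunE opp_lfunE comp_lfunE.
  by rewrite projv_id // subrr.
exists (e \o D^-1 \o quotv_proj (limg c))%VF, Y; split.
- apply/lfunP=> v; rewrite !comp_lfunE zero_lfunE.
  have /eqP -> : quotv_proj (limg c) (c v) == 0.
    by rewrite quotv_proj_eq0 memv_img ?memvf.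
  by rewrite !linear0.
- apply/lfunP=> w; rewrite comp_lfunE [Y w]comp_lfunE lfun_vsvalE zero_lfunE.
  by apply/eqP; rewrite -memv_ker subvsP.
have -> : ((e \o D^-1 \o quotv_proj (limg c)) \o d)%VF = e.
  rewrite [RHS](lfun_factorl De); apply/lfunP=> w.
  by rewrite !comp_lfunE eD.
by rewrite [RHS]addrC -[RHS]addrA subrK [RHS]addrC subrK.
Qed.

Lemma blocks_quadruple_orbit a b c d a' b' c' d' x :
    blocks_quadruple a b c d x -> blocks_quadruple a' b' c' d' x ->
  exists X Y, [/\ c' = c, a' = (a + (X \o c))%VF, d' = (d + (c \o Y))%VF &
                  b' = (((a + (X \o c)) \o Y) + (b + (X \o d)))%VF].
Proof.
move=> qx qx'; have ecc : c' = c by case: qx qx' => [<- _ _ _] [<- _ _ _].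
subst c'.
have [X0 aX] : exists X0, a' = (a + (X0 \o c))%VF.
  suff ca : (lker c <= lker (a' - a))%VS.
    by exists ((a' - a) \o c^-1)%VF; rewrite -lfun_factorl // addrC subrK.
  case: x qx qx' => C A D B [/= eC eA _ _] [/= _ eA' _ _]; subst C.
  apply/subvP=> v vK; rewrite memv_ker add_lfunE opp_lfunE subr_eq0.
  by rewrite -(vsprojK vK) -eA -eA'.
have [Y0 dY] : exists Y0, d' = (d + (c \o Y0))%VF.
  suff dc : (limg (d' - d) <= limg c)%VS.
    by exists (c^-1 \o (d' - d))%VF; rewrite -lfun_factorr // addrC subrK.
  case: x qx qx' => C A D B [/= eC _ eD _] [/= _ _ eD' _]; subst C.
  apply/subvP=> _ /memv_imgP [w _ ->]; rewrite add_lfunE opp_lfunE.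
  by rewrite -quotv_projE -eD -eD'.
have := blocks_quadruple_unip X0 Y0 qx; rewrite -aX -dY => qx1.
have [X1 [Y1 [X1c cY1 ->]]] := blocks_quadruple_corner qx1 qx'.
exists (X0 + X1), (Y0 + Y1).
rewrite comp_lfunDl X1c addr0 -aX comp_lfunDr cY1 addr0 -dY; split=> //.
have -> : (X1 \o d' = X1 \o d)%VF.
  by rewrite dY comp_lfunDr comp_lfunA X1c comp_lfun0l addr0.
by rewrite comp_lfunDr comp_lfunDl -!addrA [RHS]addrCA.
Qed.

End Blocks.

(** * Invertible matrices as block maps *)

Section Matrices.

Variables (F : finFieldType) (n : nat) (V W : {vspace 'cV[F]_n.-1.+1}).
Hypotheses (VW_sum : (V + W)%VS = fullv) (VW_direct : directv (V + W)%VS).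
Implicit Types (g h u : {'GL_n[F]}) (p : subvs_of V * subvs_of W).

Definition glue p : 'cV[F]_n.-1.+1 := vsval p.1 + vsval p.2.

Definition cut (z : 'cV[F]_n.-1.+1) : subvs_of V * subvs_of W :=
  (proj_along V W z, proj_along W V z).

Lemma cutK : cancel cut glue.
Proof.
have projE (Q Q' : {vspace 'cV[F]_n.-1.+1}) z :
    vsval (proj_along Q Q' z) = daddv_pi Q Q' z.
  by rewrite lfunE /= vsprojK ?memv_pi.
move=> z; rewrite /glue /= !projE daddv_pi_add ?VW_sum ?memvf //.
exact/directv_addP.
Qed.

Lemma glueK : cancel glue cut.
Proof.
move=> p; have /eqP := cutK (glue p); rewrite {1 3}/glue.
rewrite (directv_add_unique VW_direct) ?subvsP // => /eqP[e1 e2].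
by case: p e1 e2 => p1 p2 e1 e2; congr pair; apply: val_inj.
Qed.

Definition blocks_of g : subvs_of V * subvs_of W -> subvs_of V * subvs_of W :=
  block_fun (blockA V W g) (blockB V W g) (blockC V W g) (blockD V W g).

(** The block map is g conjugated by the identification of V * W with the
    ambient space; multiplicativity and bijectivity follow from this. *)
Lemma blocks_ofE g p : blocks_of g p = cut (GLval g *m glue p).
Proof.
rewrite mulmxDr /cut !linearD /= /blocks_of /block_fun.
rewrite /blockA /blockB /blockC /blockD /block !comp_lfunE !lfun_vsvalE.
by rewrite [GLact g _]lfunE [GLact g (vsval p.2)]lfunE.
Qed.

Lemma blocks_ofM g h p : blocks_of (g * h)%g p = blocks_of g (blocks_of h p).
Proof. by rewrite !blocks_ofE cutK GL_MxE mulmxA. Qed.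

Lemma blocks_of1 p : blocks_of 1%g p = p.
Proof. by rewrite blocks_ofE GL_1E mul1mx glueK. Qed.

Lemma blocks_of_bij g : bijective (blocks_of g).
Proof.
by exists (blocks_of g^-1%g) => p; rewrite -blocks_ofM ?mulVg ?mulgV blocks_of1.
Qed.

Lemma blocks_of_inj g h : blocks_of g =1 blocks_of h -> g = h.
Proof.
move=> e; apply/val_inj/trmx_inj/row_matrixP=> i /=; apply: trmx_inj.
rewrite !tr_row !trmxK !colE -[delta_mx i 0]cutK.
by apply: (can_inj cutK); rewrite -!blocks_ofE e.
Qed.

Lemma blocks_of_exists a b c d : injective (block_fun a b c d) ->
  {g | blocks_of g =1 block_fun a b c d}.
Proof.
move=> f_inj.
pose f : 'End('cV[F]_n.-1.+1) :=
  ((linfun (@vsval F _ V) \o ((a \o proj_along V W) + (b \o proj_along W V))) +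
   (linfun (@vsval F _ W) \o ((c \o proj_along V W) + (d \o proj_along W V)))
  )%VF.
have fE z : f z = glue (block_fun a b c d (cut z)).
  by rewrite !lfunE /= !comp_lfunE !lfun_vsvalE !add_lfunE !comp_lfunE.
(* [lin1_mx] represents maps of row vectors, whence the transpositions. *)
pose M := (lin1_mx (trmx \o f \o trmx))^T.
have ME z : M *m z = f z.
  by apply: trmx_inj; rewrite trmx_mul trmxK mul_rV_lin1 /= trmxK.
have Mu : M \in unitmx.
  rewrite -unitmx_tr -row_free_unit; apply: inj_row_free => v vM.
  apply: trmx_inj; rewrite trmx0; apply: (can_inj cutK); apply: f_inj.
  apply: (can_inj glueK); rewrite -!fE linear0 -ME.
  by apply: trmx_inj; rewrite trmx_mul trmxK vM trmx0.
exists (FinRing.Unit Mu) => p.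
by rewrite blocks_ofE ME fE !glueK.
Qed.

(** * Double cosets of the unipotent group *)

Lemma unipP u : reflect (exists X : 'Hom(subvs_of W, subvs_of V),
    blocks_of u =1 block_fun \1%VF X 0 \1%VF) (u \in unip V W).
Proof.
rewrite inE; apply: (iffP and3P) => [[/eqP a1 /eqP c0 /eqP d1] | [X]].
  by exists (blockB V W u); rewrite /blocks_of a1 c0 d1.
by move=> /block_fun_inj [-> _ -> ->].
Qed.

Lemma unip_exists X :
  {u | u \in unip V W & blocks_of u =1 block_fun \1%VF X 0 \1%VF}.
Proof.
have [|u uE] := @blocks_of_exists \1%VF X 0 \1%VF; last first.
  by exists u => //; apply/unipP; exists X.
move=> [v w] [v' w']; rewrite /block_fun /= !id_lfunE !zero_lfunE !add0r => e.
by have := congr1 fst e; rewrite /= (congr1 snd e : w = w') => /addIr ->.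
Qed.

Lemma group_set_unip : group_set (unip V W).
Proof.
apply/group_setP; split=> [|u h /unipP [X uX] /unipP [Y hY]]; apply/unipP.
  exists 0 => p; rewrite blocks_of1 /block_fun !id_lfunE !zero_lfunE.
  by rewrite addr0 add0r; case: p.
exists (X + Y) => p; rewrite blocks_ofM hY uX /block_fun /=.
by rewrite !id_lfunE !zero_lfunE !add0r add_lfunE -addrA [Y _ + _]addrC.
Qed.

(** Multiplying by two unipotent matrices is the change of blocks computed in
    [block_fun_unip], so the invariance and the separation results for blocks
    both apply. *)
Lemma dcoset_quadrupleP g h (x : quadruple (subvs_of V) (subvs_of W)) :
  quadruple_of g x ->
  reflect (quadruple_of h x) (h \in unip V W :* g * unip V W)%g.
Proof.
move=> qg; apply: (iffP idP) => [|qh].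
  case/mulsgP=> _ u' /rcosetP [u /unipP [X uX] ->] /unipP [Y uY] eh.
  have hE p : block_fun \1%VF X 0 \1%VF
      (blocks_of g (block_fun \1%VF Y 0 \1%VF p)) = blocks_of h p.
    by rewrite eh !blocks_ofM uX uY.
  have [eA eB eC eD] := block_fun_inj (fun p => etrans (esym (block_fun_unip
    (blockA V W g) (blockB V W g) (blockC V W g) (blockD V W g) X Y p)) (hE p)).
  rewrite /quadruple_of -eA -eB -eC -eD.
  exact: (blocks_quadruple_unip X Y qg).
have [X [Y [eC eA eD eB]]] := blocks_quadruple_orbit qg qh.
have [u uU uX] := unip_exists X; have [u' uU' uY] := unip_exists Y.
have -> : h = (u * g * u')%g.
  apply: blocks_of_inj => p; rewrite !blocks_ofM uX uY /blocks_of eC eA eD eB.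
  by rewrite block_fun_unip.
by rewrite mem_mulg ?mem_rcoset ?mulgK.
Qed.

Lemma double_coset_eq (X : {set {'GL_n[F]}}) g :
  X \in double_cosets (unip V W) 'GL_n[F]%g (unip V W) -> g \in X ->
  X = (unip V W :* g * unip V W)%g.
Proof.
have [U ->] : exists U : {group {'GL_n[F]}}, unip V W = U.
  by exists (Group group_set_unip).
case/imsetP=> g0 _ -> /mulsgP [_ u' /rcosetP [u uU ->] uU' ->].
by rewrite !rcosetM (rcoset_id uU) -[RHS]mulgA lcoset_id.
Qed.

Lemma double_coset_repr (X : {set {'GL_n[F]}}) :
  X \in double_cosets (unip V W) 'GL_n[F]%g (unip V W) -> repr X \in X.
Proof.
case/imsetP=> g _ ->; apply: (@mem_repr _ _ g).
have U1 : 1%g \in unip V W by case/group_setP: group_set_unip.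
by rewrite -[g in X in X \in _]mulg1 mem_mulg // mem_rcoset mulgV.
Qed.

End Matrices.

Theorem proposition7p1 (F : finFieldType) (n k : nat)
    (V W : {vspace 'cV[F]_n.-1.+1})
    (k_ge1 : (1 <= k)%N) (k_le : (k <= n - k)%N)
    (VW_sum : (V + W)%VS = fullv) (VW_direct : directv (V + W)%VS)
    (dimV : \dim V = k) (dimW : \dim W = (n - k)%N) :
  exists phi : double_coset_space (unip V W) 'GL_n[F]%g (unip V W) ->
               admissible_quadruple (subvs_of V) (subvs_of W),
    bijective phi /\
    forall (X : double_coset_space (unip V W) 'GL_n[F]%g (unip V W))
           (g : {'GL_n[F]}),
      g \in sval X -> quadruple_of g (sval (phi X)).
Proof.
pose coset_space := double_coset_space (unip V W) 'GL_n[F]%g (unip V W).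
pose admissibles := admissible_quadruple (subvs_of V) (subvs_of W).
have dcosetP := dcoset_quadrupleP VW_sum VW_direct.
have coset_eq := double_coset_eq VW_sum VW_direct.
have coset_repr := double_coset_repr VW_sum VW_direct.
pose quad g := reduce_blocks (blockA V W g) (blockB V W g)
                             (blockC V W g) (blockD V W g).
have quadP g : quadruple_of g (quad g) by apply: reduce_blocksP.
have quad_adm g : admissible (quad g).
  apply: blocks_quadruple_admissible (quadP g); exact: blocks_of_bij.
pose phi (X : coset_space) : admissibles :=
  exist _ (quad (repr (sval X))) (quad_adm _).
have phiP (X : coset_space) g : g \in sval X -> quadruple_of g (sval (phi X)).
  move=> gX; apply/(dcosetP _ _ _ (quadP _)).
  by rewrite -(coset_eq _ _ (svalP X) (coset_repr _ (svalP X))).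
exists phi; split=> //.
have lift (x : admissibles) : {g | quadruple_of g (sval x)}.
  have [a [b [d qx]]] := blocks_quadruple_exists (sval x).
  have f_inj := block_fun_injective qx (svalP x).
  have [g gE] := blocks_of_exists VW_sum VW_direct f_inj.
  have [eA eB eC eD] := block_fun_inj gE.
  by exists g; rewrite /quadruple_of eA eB eC eD.
have coset_in g : (unip V W :* g * unip V W)%g \in
    double_cosets (unip V W) 'GL_n[F]%g (unip V W).
  by apply/imsetP; exists g; rewrite ?inE.
pose psi (x : admissibles) : coset_space :=
  exist (fun X => X \in double_cosets (unip V W) 'GL_n[F]%g (unip V W))
    _ (coset_in (sval (lift x))).
exists psi => [X | x]; apply: val_inj => /=.
  apply/esym/(coset_eq _ _ (svalP X)).
  case: (lift _) => g /= qg.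
  rewrite (coset_eq _ _ (svalP X) (coset_repr _ (svalP X))).
  by apply/(dcosetP _ _ _ (quadP _)).
apply: blocks_quadruple_uniq (svalP (lift x)); apply: (phiP (psi x)).
by apply/(dcosetP _ _ _ (svalP (lift x))); exact: (svalP (lift x)).
Qed.
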